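(* For $n\geq 2$ let $$\mathbf{w}_n:=x_0z_1xyz_2\,x_1x_0x_2x_1x_3x_2\cdots x_nx_{n-1}\,z_1xyz_2x_n$$ and let $\mathbf{w}_n'$ be the word obtained from $\mathbf{w}_n$ by switching the positions of $x$ and $y$, that is, $\mathbf{w}_n'=x_0z_1yxz_2\,x_1x_0x_2x_1x_3x_2\cdots x_nx_{n-1}\,z_1yxz_2x_n$. Then the system of monoid identities $$\Sigma:=\{\mathbf{w}_n\approx\mathbf{w}_n'\mid n\geq 2\}\cup\{xt_1xt_2x\approx x^3t_1t_2\approx t_1t_2x^3,\ x^3\approx x^4\}$$ is irredundant.
   Context: Here $x,y,z_1,z_2,t_1,t_2,x_0,x_1,x_2,\dots$ are distinct variables from a countably infinite alphabet $\mathscr{A}$, and $\mathscr{A}^*$ is the free monoid over $\mathscr{A}$. The segment $x_1x_0x_2x_1x_3x_2\cdots x_nx_{n-1}$ is the product over $i=1,\dots,n$ (in increasing order) of the two-letter words $x_ix_{i-1}$. The chain $xt_1xt_2x\approx x^3t_1t_2\approx t_1t_2x^3$ abbreviates the two identities $xt_1xt_2x\approx x^3t_1t_2$ and $x^3t_1t_2\approx t_1t_2x^3$. Monoids are algebras in the signature $\{\cdot,1\}$. A monoid identity is an expression $\mathbf{u}\approx\mathbf{v}$ with $\mathbf{u},\mathbf{v}\in\mathscr{A}^*$; a monoid $\mathbf{M}$ satisfies it if $\mathbf{u}\theta=\mathbf{v}\theta$ for every substitution $\theta:\mathscr{A}\to\mathbf{M}$ (so variables may be assigned $1$). An identity is a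 consequence of a set of identities if every monoid satisfying the set satisfies it. A set $\Sigma$ of identities is irredundant if no $\sigma\in\Sigma$ is a consequence of $\Sigma\setminus\{\sigma\}$. *)

(* Defs.v *)
From mathcomp Require Import all_boot.
From mathcomp Require Import classical_sets.

Set Implicit Arguments.
Unset Strict Implicit.
Unset Printing Implicit Defensive.

Local Open Scope classical_set_scope.

(* The countably infinite alphabet; [lxi i] is the variable x_i, and is
   distinct from [lx], the variable x. *)
Inductive letter : Set :=
  | lx | ly | lz1 | lz2 | lt1 | lt2
  | lxi of nat.

(* The free monoid over [letter]: [::] is the empty word, ++ the product. *)
Definition word : Type := seq letter.

Record identity : Type := Identity { lhs : word; rhs : word }.

Notation "u =~ v" := (Identity u v) (at level 70, no associativity).

(* The value of a word under the homomorphic extension of [theta]. *)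
Definition eval (M : monoidType) (theta : letter -> M) (u : word) : M :=
  (\prod_(a <- u) theta a)%g.

Definition satisfies (M : monoidType) (e : identity) : Prop :=
  forall theta : letter -> M, eval theta (lhs e) = eval theta (rhs e).

(* A [monoidType] carries a choice structure on its carrier; classically this
   excludes no monoid. *)
Definition consequence (S : set identity) (e : identity) : Prop :=
  forall M : monoidType, (forall s, S s -> satisfies M s) -> satisfies M e.

Definition irredundant (S : set identity) : Prop :=
  forall s, S s -> ~ consequence (S `\ s) s.

(* x_1 x_0 x_2 x_1 ... x_n x_{n-1} *)
Definition segment (n : nat) : word :=
  flatten [seq [:: lxi i; lxi i.-1] | i <- iota 1 n].

(* w_n = wword n x y and w_n' = wword n y x. *)
Definition wword (n : nat) (a b : letter) : word :=
  [:: lxi 0; lz1; a; b; lz2] ++ segment n ++ [:: lz1; a; b; lz2; lxi n].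

Definition w (n : nat) : word := wword n lx ly.
Definition w' (n : nat) : word := wword n ly lx.

Definition Sigma : set identity :=
  [set (w n =~ w' n) | n in [set n | 2 <= n]] `|`
  [set ([:: lx; lt1; lx; lt2; lx] =~ nseq 3 lx ++ [:: lt1; lt2]);
       (nseq 3 lx ++ [:: lt1; lt2] =~ [:: lt1; lt2] ++ nseq 3 lx);
       (nseq 3 lx =~ nseq 4 lx)].

(* Main.v *)
From HB Require Import structures.
From mathcomp Require Import all_boot.
From mathcomp Require Import classical_sets zify.
Require Import Defs.

Set Implicit Arguments.
Unset Strict Implicit.
Unset Printing Implicit Defensive.

Local Open Scope classical_set_scope.
Local Open Scope quotient_scope.

(** Each identity of Sigma is separated from the others by a monoid that
satisfies the others and not it. The monoids are quotients of free monoids by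
the kernel of a map f on words that is compatible with concatenation; such a
quotient satisfies an identity exactly when f takes equal values on its two
sides after every substitution of words for letters
([satisfies_quot]). So only words have to be studied.

Every letter of w_n occurs exactly twice, which decides the choice of the maps.

- To separate w_n, take a Rees quotient: all words that are not factors of a
  fixed word W are identified with each other and become a zero. If no letter
  occurs three times in W, then every element other than 1 has cube 0, and the
  three cube identities hold. It remains to find a W that is a value of w_n,
  while no w_m with m <> n has a factor of W as a value, except when h(x) or
  h(y) is empty, where w_m and w'_m agree. Such a word is obtained from w_n by
  deleting z_1 and z_2: the only factor of length two that is repeated in

    W = x_0 x y (x_1 x_0 x_2 x_1 ... x_n x_(n-1)) x y x_n

  is xy ([repeated_factor]). If a substitution h sends w_m to a factor of W and
  h(x), h(y) are not empty, then the last letter of h(x) and the first letter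
  of h(y) form a repeated factor, hence are these two letters; this anchors the
  image of the segment at the segment of W, and h(x_0), h(x_m) inside the
  letters x_0, x_n around it. A parity count gives h(x_0) = x_0 and
  h(x_m) = x_n, and reading the segment from the left then forces
  h(x_i) = x_i step by step, so that m = n ([wword_in_rword]).

- The identity that gathers three occurrences of x fails in the Rees quotient
  for W = abaa, where cubes of nontrivial elements are still 0, and which has
  no factor of length at least four with an even number of a's.

- The centrality of cubes fails for the map that remembers the order in which
  the letters of a two-letter alphabet first occur, with all words that contain
  one of the two letters, say b, at least twice identified. Moving later
  occurrences of x does not change that order, so that the other cube
  identities hold. As all letters of w_m occur twice, the image of w_m contains
  b at least twice or not at all, and in the second case it is a power of the
  other letter.

- x^3 = x^4 fails in the group of order two, which is commutative. *)

(** * Monoids as quotients of free monoids *)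

Definition subst (T : Type) (h : letter -> seq T) (u : word) : seq T :=
  flatten [seq h a | a <- u].

Lemma subst_cat (T : Type) (h : letter -> seq T) u v :
  subst h (u ++ v) = subst h u ++ subst h v.
Proof. by rewrite /subst map_cat flatten_cat. Qed.

Lemma count_subst (T : Type) (h : letter -> seq T) (p : pred T) u :
  count p (subst h u) = \sum_(a <- u) count p (h a).
Proof. by rewrite /subst count_flatten sumnE !big_map. Qed.

Definition holds_mod (T S : Type) (f : seq T -> S) (e : identity) : Prop :=
  forall h : letter -> seq T, f (subst h (lhs e)) = f (subst h (rhs e)).

(** The kernel of f is a congruence of the free monoid. *)
Definition congruent (T S : Type) (f : seq T -> S) : Prop :=
  forall c a b d, f a = f b -> f (c ++ a ++ d) = f (c ++ b ++ d).

Section KernelQuotient.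
Variables (T : choiceType) (S : eqType) (f : seq T -> S).
Hypothesis f_cong : congruent f.

Definition ker_rel : rel (seq T) := fun u v => f u == f v.

Lemma ker_rel_equiv : equiv_class_of ker_rel.
Proof.
split=> [u | u v | v u t]; rewrite /ker_rel ?eqxx //.
by move=> /eqP->.
Qed.

Canonical ker_equiv := EquivRelPack ker_rel_equiv.

Definition ker_quot := {eq_quot ker_equiv}.
HB.instance Definition _ := Choice.on ker_quot.

Lemma pi_ker u v : \pi_ker_quot u = \pi_ker_quot v <-> f u = f v.
Proof. by split=> [/eqmodP/eqP | fE]; last by apply/eqmodP/eqP. Qed.

Lemma f_repr u : f (repr (\pi_ker_quot u)) = f u.
Proof. by apply/pi_ker; rewrite reprK. Qed.

Definition ker_mul (p q : ker_quot) : ker_quot :=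
  \pi_ker_quot (repr p ++ repr q).

Lemma ker_mul_pi u v :
  ker_mul (\pi_ker_quot u) (\pi_ker_quot v) = \pi_ker_quot (u ++ v).
Proof.
apply/pi_ker.
have := f_cong [::] (repr (\pi_ker_quot v)) (f_repr u) => /= ->.
by have := f_cong u [::] (f_repr v); rewrite !cats0.
Qed.

Lemma ker_quotW (P : ker_quot -> Prop) :
  (forall u, P (\pi_ker_quot u)) -> forall p, P p.
Proof. by move=> Ppi p; rewrite -[p]reprK. Qed.

Lemma ker_mulA : associative ker_mul.
Proof.
elim/ker_quotW=> u; elim/ker_quotW=> v; elim/ker_quotW=> t.
by rewrite !ker_mul_pi; rewrite catA.
Qed.

Lemma ker_mul1 : left_id (\pi_ker_quot [::]) ker_mul.
Proof. by elim/ker_quotW=> u; rewrite ker_mul_pi. Qed.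

Lemma ker_mulr1 : right_id (\pi_ker_quot [::]) ker_mul.
Proof. by elim/ker_quotW=> u; rewrite ker_mul_pi cats0. Qed.

HB.instance Definition _ := isMonoid.Build ker_quot ker_mulA ker_mul1 ker_mulr1.
Definition ker_monoid : monoidType := ker_quot.

Lemma eval_pi (h : letter -> seq T) u :
  eval (M := ker_monoid) (fun a => \pi_ker_quot (h a)) u =
  \pi_ker_quot (subst h u).
Proof.
rewrite /eval; elim: u => [|a u IHu]; first by rewrite big_nil.
by rewrite big_cons IHu; exact: ker_mul_pi.
Qed.

(** A substitution into the quotient lifts to a substitution of words because
the projection is onto, and the value of a word is then the class of the
substituted word. *)
Lemma satisfies_quot e : satisfies ker_monoid e <-> holds_mod f e.
Proof.
split=> [sat h | holds theta].
  by apply/pi_ker; rewrite -!eval_pi; apply: sat.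
have lift u : eval theta u = \pi_ker_quot (subst (fun a => repr (theta a)) u).
  by rewrite -eval_pi /eval; apply: eq_bigr => a _; rewrite reprK.
by rewrite !lift; apply/pi_ker.
Qed.

End KernelQuotient.

Lemma not_consequence (T : choiceType) (S : eqType) (f : seq T -> S)
    (X : set identity) (e : identity) :
  congruent f -> (forall s, X s -> holds_mod f s) -> ~ holds_mod f e ->
  ~ consequence X e.
Proof.
move=> f_cong fX fNe /(_ (ker_monoid f_cong)) sat; apply: fNe.
by apply/(satisfies_quot f_cong)/sat => s /fX /(satisfies_quot f_cong).
Qed.

(** * The two sides of the identities *)

Definition letter_code (a : letter) : nat :=
  match a with
  | lx => 0 | ly => 1 | lz1 => 2 | lz2 => 3 | lt1 => 4 | lt2 => 5
  | lxi i => i.+4.+2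
  end.

Definition letter_decode (n : nat) : letter :=
  match n with
  | 0 => lx | 1 => ly | 2 => lz1 | 3 => lz2 | 4 => lt1 | 5 => lt2
  | i.+4.+2 => lxi i
  end.

Lemma letter_codeK : cancel letter_code letter_decode.
Proof. by case. Qed.

HB.instance Definition _ := Countable.copy letter (can_type letter_codeK).

Lemma eq_lxi i j : (lxi i == lxi j) = (i == j).
Proof. by []. Qed.

(** The part of length 2k of the segment that starts at x_(i+1) x_i. Arguments
by induction on the segment remove letters from the left, which moves i. *)
Definition ladder (i k : nat) : word :=
  flatten [seq [:: lxi j.+1; lxi j] | j <- iota i k].

Lemma segmentE n : segment n = ladder 0 n.
Proof. by rewrite /segment /ladder (iotaDl 1 0) -map_comp. Qed.

Lemma mem_ladder i k a :
  a \in ladder i k -> exists2 j, a = lxi j & i <= j <= i + k.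
Proof.
case/flatten_mapP=> j; rewrite mem_iota !inE => /andP[ij jk].
by case/orP=> /eqP aE; [exists j.+1 | exists j] => //; lia.
Qed.

Lemma ladder_notin i k a :
  (forall j, i <= j -> a != lxi j) -> a \notin ladder i k.
Proof.
by move=> aN; apply/negP => /mem_ladder[j aE /andP[/aN]]; rewrite aE eqxx.
Qed.

Lemma last_ladder i k : last (lxi i) (ladder i.+1 k) = lxi (i + k).
Proof. by elim: k i => [|k IHk] i /=; rewrite ?addn0 // IHk addnS. Qed.

(** In the ladder every letter occurs twice, except for the first and the last
one, of which the missing copies stand outside the segment in w_n. *)
Lemma perm_ladder i k :
  perm_eq (lxi i :: ladder i k ++ [:: lxi (i + k)])
    (map lxi (iota i k.+1) ++ map lxi (iota i k.+1)).
Proof.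
apply/permP => p; elim: k i => [|k IHk] i /=; first by rewrite !addn0.
have := IHk i.+1; rewrite -/(ladder i.+1 k) /= !count_cat /= addnS addSn => IH.
by lia.
Qed.

Lemma perm_wword m a b :
  let half := [:: lz1; a; b; lz2] ++ map lxi (iota 0 m.+1) in
  perm_eq (wword m a b) (half ++ half).
Proof.
apply/permP => p; have /permP/(_ p) := perm_ladder 0 m.
by rewrite /wword segmentE /= !count_cat /= add0n; lia.
Qed.

Lemma even_count_wword (T : Type) (h : letter -> seq T) (p : pred T) m a b :
  odd (count p (subst h (wword m a b))) = false.
Proof.
rewrite count_subst (perm_big _ (perm_wword m a b)) big_cat /= addnn.
exact: odd_double.
Qed.

Lemma perm_count_w (T : Type) (h : letter -> seq T) (p : pred T) m :
  count p (subst h (w m)) = count p (subst h (w' m)).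
Proof.
rewrite !count_subst; apply/perm_big/permP => a.
by rewrite /w /w' /wword /= !count_cat /=; lia.
Qed.

Definition cube_gather : identity :=
  [:: lx; lt1; lx; lt2; lx] =~ nseq 3 lx ++ [:: lt1; lt2].

Definition cube_central : identity :=
  nseq 3 lx ++ [:: lt1; lt2] =~ [:: lt1; lt2] ++ nseq 3 lx.

Definition cube_stable : identity := nseq 3 lx =~ nseq 4 lx.

(** * Rees quotients *)

(** The value None is the zero of the quotient. *)
Definition rees (T : eqType) (W s : seq T) : option (seq T) :=
  if infix s W then Some s else None.

Lemma rees_congruent (T : eqType) (W : seq T) : congruent (rees W).
Proof.
move=> c a b d; rewrite /rees.
have sub s : infix (c ++ s ++ d) W -> infix s W.
  by apply: infix_trans; apply: infix_infix.
case: (boolP (infix a W)) => [_|aN]; case: (boolP (infix b W)) => [_|bN] //.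
  by case=> ->.
by rewrite (contraNF (@sub a) aN) (contraNF (@sub b) bN).
Qed.

Lemma rees_eq (T : eqType) (W u v : seq T) :
  (infix u W || infix v W -> u = v) -> rees W u = rees W v.
Proof.
rewrite /rees; case: (boolP (infix u W)) => [uW|uN].
  by move=> /(_ isT) <-; rewrite uW.
by case: ifP => // vW /(_ isT) uv; rewrite uv vW in uN.
Qed.

(** If x or y is sent to the empty word the two sides of the identity become
equal; otherwise the hypothesis makes both of them zero. *)
Lemma rees_w (T : eqType) (W : seq T) m :
  (forall h a b, h a != [::] -> h b != [::] ->
     ~~ infix (subst h (wword m a b)) W) ->
  holds_mod (rees W) (w m =~ w' m).
Proof.
move=> WN h; case: (eqVneq (h lx) [::]) => [hx|hx].
  by rewrite /subst /= !map_cat /= !flatten_cat /= hx /=.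
case: (eqVneq (h ly) [::]) => [hy|hy].
  by rewrite /subst /= !map_cat /= !flatten_cat /= hy /=.
apply: rees_eq => /=.
by rewrite (negPf (WN h _ _ hx hy)) (negPf (WN h _ _ hy hx)).
Qed.

Definition cubefree (T : eqType) (W : seq T) : Prop :=
  forall x, infix (x ++ x ++ x) W -> x = [::].

Lemma rees_cube_central (T : eqType) (W : seq T) : cubefree W ->
  holds_mod (rees W) cube_central.
Proof.
move=> Wcf h; apply: rees_eq; rewrite !subst_cat /= => W3.
suff x0 : h lx = [::] by rewrite /subst /= x0 /= !cats0.
apply: Wcf; rewrite -[in X in _ ++ _ ++ X](cats0 (h lx)).
case/orP: W3; apply: infix_trans.
  exact/infix_catr/infix_refl.
exact/infix_catl/infix_refl.
Qed.

Lemma rees_cube_stable (T : eqType) (W : seq T) : cubefree W ->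
  holds_mod (rees W) cube_stable.
Proof.
move=> Wcf h; apply: rees_eq; rewrite /subst /= !cats0 => W3.
suff -> : h lx = [::] by [].
apply: Wcf; case/orP: W3 => //; apply: infix_trans.
exact/infix_catl/infix_refl.
Qed.

Lemma rees_gather (T : eqType) (W : seq T) : (forall c, count_mem c W <= 2) ->
  holds_mod (rees W) cube_gather.
Proof.
move=> W2 h; apply: rees_eq; rewrite /subst /= !cats0.
case: (h lx) => [_|c x W3]; first by rewrite !cats0.
exfalso; suff : 2 < count_mem c W by rewrite ltnNge W2.
by case/orP: W3 => /infixP[p [q ->]];
  rewrite !count_cat /= ?count_cat /= ?count_cat /= !eqxx; lia.
Qed.

Lemma cubefree_count (T : eqType) (W : seq T) :
  (forall c, count_mem c W <= 2) -> cubefree W.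
Proof.
move=> W2 [|c x] // /infixP[p [q WE]].
have := W2 c; rewrite WE !count_cat /= ?count_cat /= ?count_cat /= !eqxx.
by lia.
Qed.

Lemma infix_count (T : eqType) (p : pred T) (s t : seq T) :
  infix s t -> count p s <= count p t.
Proof. by case/infixP=> [a [b ->]]; rewrite !count_cat; lia. Qed.

Lemma infix_eq_size (T : eqType) (s t : seq T) :
  infix s t -> size t <= size s -> s = t.
Proof.
case/infixP=> [p [q ->]]; rewrite !size_cat => le_size.
have /nilP-> : nilp p by rewrite /nilp; lia.
have /nilP-> : nilp q by rewrite /nilp; lia.
by rewrite cats0.
Qed.

(** * Separating one of the identities between w_n and w'_n *)

Lemma cat_cons_inj (T : eqType) (a : T) s1 s2 t1 t2 :
  a \notin s1 -> a \notin t1 -> s1 ++ a :: s2 = t1 ++ a :: t2 ->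
  s1 = t1 /\ s2 = t2.
Proof.
move=> aNs aNt E.
have sz : size s1 = size t1.
  have := congr1 (index a) E.
  by rewrite !index_cat (negPf aNs) (negPf aNt) !index_head !addn0.
by move/eqP: E; rewrite eqseq_cat // => /andP[/eqP-> /eqP[->]].
Qed.

Lemma cat_eq_singleton (T : Type) (a : T) s t :
  [:: a] = s ++ t -> (s = [::] /\ t = [:: a]) \/ (s = [:: a] /\ t = [::]).
Proof.
case: s => [|b s] /=; first by left.
by case=> <-; case: s => [|//]; case: t => [|//]; right.
Qed.

(** The word w_n without the letters z_1 and z_2. Deleting these leaves lx ly as
the only repeated factor of length two, so that the image of a w_m can be
placed in it in one way only. *)
Definition rword (n : nat) : word :=
  [:: lxi 0; lx; ly] ++ segment n ++ [:: lx; ly; lxi n].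

Definition adjacent (a : letter) (s : word) : seq (letter * letter) :=
  pairmap pair a s.

Lemma mem_adjacent a s c d :
  (c, d) \in adjacent a s -> c \in a :: s /\ d \in s.
Proof.
elim: s a => //= b s IHs a; rewrite inE => /orP[/eqP[-> ->]|/IHs[cs ds]].
  by rewrite !inE !eqxx.
by split; rewrite in_cons ?cs ?ds orbT.
Qed.

(** The first two pairs are (x_i, x_(i+2)) and (x_(i+2), x_(i+1)). Later pairs
differ from both, as their first letter has index at least i+1 and their second
letter has index at least i+2. *)
Lemma uniq_adjacent_ladder i k : uniq (adjacent (lxi i) (ladder i.+1 k)).
Proof.
elim: k i => //= k IHk i; rewrite IHk !inE xpair_eqE !eq_lxi andbT.
have low j : lxi j \in ladder i.+2 k -> i.+2 <= j.
  by case/mem_ladder=> l [->] /andP[].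
apply/andP; split.
  apply/norP; split; first by apply/negP => /andP[/eqP]; lia.
  by apply/negP=> /mem_adjacent[]; rewrite inE => /orP[/eqP[]|/low]; lia.
by apply/negP=> /mem_adjacent[_ /low]; lia.
Qed.

Lemma count_adjacent_twice e c d u v t :
  1 < count_mem (c, d) (adjacent e (u ++ [:: c, d & v] ++ [:: c, d & t])).
Proof.
rewrite /adjacent pairmap_cat count_cat /= pairmap_cat count_cat /= !eqxx.
lia.
Qed.

Lemma repeated_factor n c d u v t : 2 <= n ->
  rword n = u ++ [:: c, d & v] ++ [:: c, d & t] -> (c, d) = (lx, ly).
Proof.
case: n => [|k] // k_gt0 E.
(* lz1 does not occur in rword and serves as a left end marker. *)
have := count_adjacent_twice lz1 c d u v t; rewrite -E => {E} twice.
apply/eqP/contraT => cdN; move: twice; rewrite ltnNge.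
pose F := adjacent (lxi 0) (ladder 1 k).
pose L := [:: (lz1, lxi 0); (lxi 0, lx); (ly, lxi 1); (lxi 1, lxi 0)]
            ++ F ++ [:: (lxi k, lx); (ly, lxi k.+1)].
have -> : count_mem (c, d) (adjacent lz1 (rword k.+1)) = count_mem (c, d) L.
  rewrite /rword segmentE -[ladder 0 _]/([:: lxi 1; lxi 0] ++ ladder 1 k).
  rewrite /adjacent /= pairmap_cat last_ladder add0n -/F.
  by rewrite /L /= !count_cat /= [(lx, ly) == _]eq_sym (negPf cdN).
rewrite count_uniq_mem ?leq_b1 //.
have FP a b : (a, b) \in F -> exists i j, [/\ a = lxi i, b = lxi j & 0 < j].
  case/mem_adjacent=> aF /mem_ladder[j -> /andP[j_gt0 _]].
  move: aF; rewrite inE => /orP[/eqP->|/mem_ladder[i -> _]].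
    by exists 0, j.
  by exists i, j.
have FN a b :
    (forall i j, 0 < j -> (a, b) <> (lxi i, lxi j)) -> (a, b) \notin F.
  by move=> N; apply/negP=> /FP[i [j [aE bE /N]]]; apply; rewrite aE bE.
rewrite /L /= cat_uniq uniq_adjacent_ladder /= !inE !mem_cat !inE.
rewrite !xpair_eqE !eq_lxi !(negPf (FN _ _ _)) //=; try by move=> i j; case.
  have [-> ->] : (0 == k) = false /\ (1 == k.+1) = false by lia.
  by rewrite andbF.
by move=> i j j_gt0 [_ j0]; rewrite -j0 in j_gt0.
Qed.

(** Since h(x_i) = x_i occurs only once in the ladder starting at i, the letter
x_(i+1) before it must be all of h(x_(i+1)); so the identification climbs the
ladder until one of the two ladders ends. *)
Lemma ladder_rigid h n m : h (lxi m) = [:: lxi n] ->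
  forall k l i, i + k = m -> i + l = n -> h (lxi i) = [:: lxi i] ->
    subst h (ladder i k) = ladder i l -> m = n.
Proof.
move=> hm; elim=> [|k IHk] l i ikm iln hi.
  by move=> _; move: hm; rewrite -ikm addn0 hi => -[].
case: l iln => [|l] iln.
  by move=> /(congr1 (count predT)); rewrite /subst /= hi !count_cat /=; lia.
rewrite -[ladder i k.+1]/([:: lxi i.+1; lxi i] ++ ladder i.+1 k).
rewrite subst_cat {1}/subst /= hi cats0 -catA /= => E.
have xiN : lxi i \notin ladder i.+1 l.
  by apply: ladder_notin => j; rewrite eq_lxi; lia.
have xihN : lxi i \notin h (lxi i.+1).
  have := congr1 (count_mem (lxi i)) E.
  rewrite -/(ladder i.+1 l) /= !count_cat /= eqxx eq_lxi.
  rewrite (count_memPn xiN) -has_pred1 has_count.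
  by rewrite (gtn_eqF (ltnSn i)) /= => cE; lia.
have xi1N : lxi i \notin [:: lxi i.+1] by rewrite inE eq_lxi; lia.
have [hi1 E'] := cat_cons_inj (t1 := [:: lxi i.+1]) xihN xi1N E.
by apply: IHk hi1 E'; lia.
Qed.

(** The product h(a) h(b) occurs twice in the image, so the pair formed by the
last letter of h(a) and the first letter of h(b) is the repeated factor lx ly
of rword. This fixes the place of the whole image. *)
Lemma wword_in_rword n m h a b : 2 <= n -> h a != [::] -> h b != [::] ->
  infix (subst h (wword m a b)) (rword n) -> m = n.
Proof.
move=> n2; case/lastP Ea : (h a) => [//|U c] _; case Eb : (h b) => [//|d V] _.
case/infixP=> p [q E].
pose s := subst h (segment m).
(* A and B are what the image of z_1 a b z_2 has to the left and to the right of
   the repeated pair; they turn out to be empty. *)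
set A := h lz1 ++ U; set B := V ++ h lz2.
have {}E : rword n = (p ++ h (lxi 0) ++ A) ++ [:: c, d & B ++ s ++ A]
                     ++ [:: c, d & B ++ h (lxi m) ++ q].
  rewrite E /wword !subst_cat -/s /subst /= Ea Eb cats0 -cats1 /A /B.
  by rewrite -?catA /= -?catA.
have [Ec Ed] := repeated_factor n2 E; move: E; rewrite {}Ec {}Ed => E.
have lxN : lx \notin segment n by rewrite segmentE; apply: ladder_notin.
(* The letter lx occurs in rword n twice only, and E shows both occurrences. *)
have [lxN1 lxN2] : lx \notin p ++ h (lxi 0) ++ A
                /\ lx \notin B ++ s ++ A.
  have := congr1 (count_mem lx) E; rewrite !count_cat /= !count_cat /=.
  rewrite (count_memPn lxN) -!has_pred1 !has_count /= !count_cat; split; lia.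
have [] := cat_cons_inj (t1 := p ++ h (lxi 0) ++ A)
  (_ : lx \notin [:: lxi 0]) lxN1 E => // Ep [{}E].
have [Es [Eq]] := cat_cons_inj (t1 := B ++ s ++ A) lxN lxN2 E.
(* Otherwise A = x_0 would be the end of the segment, which is x_(n-1). *)
have A0 : A = [::].
  rewrite catA in Ep; have [[_ A1]|[_ //]] := cat_eq_singleton Ep.
  have := congr1 (last ly) Es; rewrite A1 catA last_cat /= segmentE.
  case: (n) n2 => [//|k] k1 /=; rewrite last_ladder => -[k0]; lia.
(* Otherwise B = x_n would be the start of the segment, which is x_1. *)
have B0 : B = [::].
  have [[//]|[B1 _]] := cat_eq_singleton Eq.
  by move: Es; rewrite B1 segmentE; case: (n) n2 => [//|k] k1 /= [k0]; lia.
rewrite A0 B0 /= cats0 in Es Eq Ep.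
rewrite cats0 in Ep.
(* Both x_0 segment(m) x_m, under h, and x_0 segment(n) x_n contain each letter
   an even number of times, and h(segment m) = segment n. *)
have par c0 : odd (count_mem c0 (h (lxi 0)) + count_mem c0 (h (lxi m)))
            = odd (count_mem c0 [:: lxi 0; lxi n]).
  have /permP/(_ (pred1 c0)) := perm_ladder 0 n.
  rewrite /= !count_cat /= -segmentE add0n Es => Pn.
  have := count_subst h (pred1 c0) (lxi 0 :: ladder 0 m ++ [:: lxi m]).
  rewrite (perm_big _ (perm_ladder 0 m)) big_cat /= addnn -segmentE.
  rewrite -cat1s !subst_cat -/s !count_cat /= => Pm.
  lia.
have h0 : h (lxi 0) = [:: lxi 0].
  have [[_ //]|[_ h0]] := cat_eq_singleton Ep.
  have := par (lxi 0); rewrite h0 /=.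
  have [[-> _]|[-> _]] := cat_eq_singleton Eq; rewrite /= ?eqxx ?eq_lxi; lia.
have hm : h (lxi m) = [:: lxi n].
  have [[hm _]|[-> _] //] := cat_eq_singleton Eq.
  by have := par (lxi n); rewrite h0 hm /= eqxx ?eq_lxi; lia.
apply: (ladder_rigid hm (k := m) (l := n) _ _ h0) => //.
by rewrite -!segmentE Es.
Qed.

Lemma rword_twice n c : count_mem c (rword n) <= 2.
Proof.
have /permP/(_ (pred1 c)) := perm_ladder 0 n.
have U : count_mem c (map lxi (iota 0 n.+1)) = (c \in map lxi (iota 0 n.+1)).
  by rewrite count_uniq_mem // map_inj_uniq ?iota_uniq // => i j [].
rewrite count_cat U /rword segmentE /= !count_cat /= add0n.
have : (c \in map lxi (iota 0 n.+1)) -> (lx != c) && (ly != c).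
  by case/mapP=> j _ ->.
have : ~~ ((lx == c) && (ly == c)) by case: (c).
by case: (lx == c); case: (ly == c); case: (c \in _) => //= _ H;
  first [by have := H isT | lia].
Qed.

(** Deleting z_1 and z_2 sends w_n to rword n, and w'_n to another word of the
same length. *)
Lemma w_neq_mod_rword n : 2 <= n -> ~ holds_mod (rees (rword n)) (w n =~ w' n).
Proof.
move=> n2 H.
pose h c := if c is lz1 then [::] else if c is lz2 then [::] else [:: c].
have hseg : subst h (segment n) = segment n.
  rewrite segmentE; elim: n 0 {n2 H} => //= k IHk i.
  rewrite -[ladder i k.+1]/([:: lxi i.+1; lxi i] ++ ladder i.+1 k).
  by rewrite subst_cat IHk.
have := H h; rewrite /= /w /w' /wword !subst_cat hseg.
rewrite -[subst h [:: lxi 0; lz1; lx; _; _]]/[:: lxi 0; lx; ly].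
rewrite -[subst h [:: lz1; lx; _; _; _]]/[:: lx; ly; lxi n] -/(rword n).
by rewrite /rees infix_refl; case: ifP => // _ [].
Qed.

Lemma w_independent n : 2 <= n ->
  ~ consequence (Sigma `\ (w n =~ w' n)) (w n =~ w' n).
Proof.
move=> n2; apply: (@not_consequence letter _ (rees (rword n))).
- exact: rees_congruent.
- move=> s [[[m m2 <-]|[[->|->]|->]] sN].
  + apply: rees_w => h a b ha hb; apply/negP => /(wword_in_rword n2 ha hb) mn.
    by case: sN; rewrite mn.
  + exact/rees_gather/rword_twice.
  + exact/rees_cube_central/cubefree_count/rword_twice.
  + exact/rees_cube_stable/cubefree_count/rword_twice.
- exact: w_neq_mod_rword.
Qed.

(** * Separating the other identities *)

(** With a and b written true and false, the left side takes the value W = abaa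
when x, t_1, t_2 are sent to a, b, 1, and the right side becomes aaab, which is
not a factor of W. The image of a word w_m with nonempty h(x) and h(y) has
length at least four, so would have to be W; but it contains true an even
number of times. *)
Lemma gather_independent :
  ~ consequence (Sigma `\ cube_gather) cube_gather.
Proof.
pose W := [:: true; false; true; true].
have Wcf : cubefree W.
  move=> x W3; have := infix_count predT W3; rewrite !count_cat !count_predT.
  case: x W3 => [//|c [|d x]] /=; last by lia.
  by case: c.
apply: (@not_consequence bool _ (rees W)).
- exact: rees_congruent.
- move=> s [[[m m2 <-] _|[[->|->]|->] sN]].
  + apply: rees_w => h a b ha hb; apply/negP => W1.
    have even c := even_count_wword h (pred1 c) m a b.
    have: 4 <= size (subst h (wword m a b)).
      rewrite (perm_size (perm_flatten (perm_map h (perm_wword m a b)))).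
      rewrite map_cat flatten_cat size_cat /= !size_cat.
      by case: (h a) ha => [|? ?] // _; case: (h b) hb => [|? ?] //= _; lia.
    by move/(infix_eq_size W1)=> WE; have := even true; rewrite WE.
  + by case: sN.
  + exact: rees_cube_central.
  + exact: rees_cube_stable.
- pose h a := match a with lx => [:: true] | lt1 => [:: false] | _ => [::] end.
  by move/(_ h).
Qed.

Lemma undup_catr (T : eqType) (s t u : seq T) :
  undup t = undup u -> undup (s ++ t) = undup (s ++ u).
Proof.
move=> E; rewrite !undup_cat E; congr (_ ++ _).
by apply: eq_filter => x; rewrite -mem_undup E mem_undup.
Qed.

Lemma undup_cat_absorb (T : eqType) (s t : seq T) :
  {subset s <= t} -> undup (s ++ t) = undup t.
Proof.
move=> st; rewrite undup_cat -[RHS]cat0s; congr (_ ++ _).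
rewrite -(filter_pred0 (undup s)); apply: eq_in_filter => x.
by rewrite mem_undup => /st ->.
Qed.

(** [undup] keeps last occurrences; applied to the reversed word it lists the
letters by their first occurrences in s, latest first. *)
Definition first_occs (s : seq bool) : option (seq bool) :=
  if 1 < count_mem true s then None else Some (undup (rev s)).

Lemma first_occs_congruent : congruent first_occs.
Proof.
move=> c a b d; rewrite /first_occs !count_cat.
(* So a single occurrence of true can be detected in the value of the map. *)
have few s :
    count_mem true s <= 1 -> count_mem true s = (true \in undup (rev s)).
  by move=> s1; rewrite mem_undup mem_rev -has_pred1 has_count; lia.
case: (ltnP 1 (count_mem true a)) => [a2|a1];
  case: (ltnP 1 (count_mem true b)) => [b2|b1] //.
  by rewrite !ifT //; lia.
case=> E; rewrite (few a) // (few b) // E; case: ifP => // _.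
congr Some; rewrite !rev_cat -!catA; apply: undup_catr.
by rewrite !undup_cat E.
Qed.

(** The image of w_m contains true an even number of times. If not at least two,
it is a power of false, which its length determines. *)
Lemma first_occs_w m : holds_mod first_occs (w m =~ w' m).
Proof.
move=> h /=; rewrite /first_occs (perm_count_w h (pred1 true) m).
case: ltnP => // few; have := even_count_wword h (pred1 true) m ly lx.
rewrite -/(w' m) => even.
have none : count_mem true (subst h (w' m)) = 0.
  by move: few even; case: (count_mem true _) => [|[|]].
have constant u : count_mem true (subst h u) = 0 ->
    subst h u = nseq (count predT (subst h u)) false.
  move=> u0; rewrite count_predT; apply/all_pred1P/allP => -[] //.
  by apply: contraTT => _; rewrite -has_pred1 has_count u0.
suff -> : subst h (w m) = subst h (w' m) by [].
have none' : count_mem true (subst h (w m)) = 0 by rewrite perm_count_w.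
by rewrite (constant _ none) (constant _ none') perm_count_w.
Qed.

(** Both sides have the same letters equally often, and x occurs first in both,
so that its further occurrences do not matter. *)
Lemma first_occs_gather : holds_mod first_occs cube_gather.
Proof.
move=> h; rewrite /subst /= !cats0 /first_occs !count_cat.
set x := h lx; set t1 := h lt1; set t2 := h lt2.
have -> : forall i j k : nat, i + (j + (i + (k + i))) = i + (i + (i + (j + k))).
  by move=> i j k; lia.
case: ifP => // _; congr Some; rewrite !rev_cat -!catA.
rewrite undup_cat_absorb; last first.
  by move=> c cx; rewrite !mem_cat cx !orbT.
apply: undup_catr; rewrite undup_cat_absorb; last first.
  by move=> c cx; rewrite !mem_cat cx !orbT.
by apply: undup_catr; rewrite !undup_cat_absorb // => c cx; rewrite mem_cat cx.
Qed.

Lemma first_occs_cube : holds_mod first_occs cube_stable.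
Proof.
move=> h; rewrite /subst /= !cats0 /first_occs !count_cat.
set x := h lx; set k := count_mem true x.
have -> : (1 < k + (k + (k + k))) = (1 < k + (k + k)) by lia.
case: ifP => // _; congr Some; rewrite !rev_cat -!catA.
by rewrite !undup_cat_absorb // => c cx; rewrite !mem_cat cx.
Qed.

Lemma cube_central_independent :
  ~ consequence (Sigma `\ cube_central) cube_central.
Proof.
apply: (@not_consequence bool _ first_occs).
- exact: first_occs_congruent.
- move=> s [[[m m2 <-] _|[[->|->]|->] sN]].
  + exact: first_occs_w.
  + exact: first_occs_gather.
  + by case: sN.
  + exact: first_occs_cube.
- pose h a := match a with lx => [:: false] | lt1 => [:: true] | _ => [::] end.
  by move/(_ h).
Qed.

Lemma cube_stable_independent :
  ~ consequence (Sigma `\ cube_stable) cube_stable.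
Proof.
apply: (@not_consequence unit _ (fun s => odd (size s))).
- by move=> c a b d E; rewrite !size_cat !oddD E.
- move=> s [[[m m2 <-] _|[[->|->]|->] sN]] h.
  + by rewrite -!count_predT perm_count_w.
  + by congr odd; rewrite /subst /= !size_cat /=; lia.
  + by congr odd; rewrite /subst /= !size_cat /=; lia.
  + by case: sN.
- by move/(_ (fun=> [:: tt])).
Qed.

Theorem lemma3p1 : irredundant Sigma.
Proof.
move=> s [[n n2 <-]|[[->|->]|->]].
- exact: w_independent.
- exact: gather_independent.
- exact: cube_central_independent.
- exact: cube_stable_independent.
Qed.
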